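(* Let $\mathbf{D}_{\mathrm{surj}}$ be the category whose objects are finite distributive lattices and whose morphisms are surjective lattice homomorphisms. Then $\mathbf{D}_{\mathrm{surj}}$ does not have the dual Ramsey property for objects.
   Context: Lattices are considered with bottom $0$ and top $1$ in the signature (so homomorphisms preserve $0$ and $1$; for surjective homomorphisms this is automatic). For a category $\mathbf{C}$ and objects $\mathcal{A},\mathcal{B}$, define $\sim_{\mathcal{A}}$ on $\hom_{\mathbf{C}}(\mathcal{A},\mathcal{B})$ by: $f\sim_{\mathcal{A}} f'$ iff $f'=f\cdot\alpha$ for some invertible morphism $\alpha\in\hom_{\mathbf{C}}(\mathcal{A},\mathcal{A})$. Put $\binom{\mathcal{B}}{\mathcal{A}}_{\mathbf{C}}=\hom_{\mathbf{C}}(\mathcal{A},\mathcal{B})/\!\sim_{\mathcal{A}}$; for $w\in\hom_{\mathbf{C}}(\mathcal{B},\mathcal{C})$ put $w\cdot(f/\!\sim_{\mathcal{A}})=(w\cdot f)/\!\sim_{\mathcal{A}}$. A $k$-coloring of a set $\mathcal{S}$ is a decomposition $\mathcal{S}=\mathcal{M}_1\cup\dots\cup\mathcal{M}_k$ with $\mathcal{M}_i\cap\mathcal{M}_j=\varnothing$ for $i\neq j$ (blocks may be empty). The category $\mathbf{C}$ has the Ramsey property for objects if for every integer $k\ge 2$ and all objects $\mathcal{A},\mathcal{B}$ with $\hom_{\mathbf{C}}(\mathcal{A},\mathcal{B})\ne\varnothing$ there is an object $\mathcal{C}$ such that for every $k$-coloring $\binom{\mathcal{C}}{\mathcal{A}}_{\mathbf{C}}=\mathcal{M}_1\cup\dots\cup\mathcal{M}_k$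 there are $i$ and $w\in\hom_{\mathbf{C}}(\mathcal{B},\mathcal{C})$ with $w\cdot\binom{\mathcal{B}}{\mathcal{A}}_{\mathbf{C}}\subseteq\mathcal{M}_i$. The category $\mathbf{C}$ has the dual Ramsey property for objects if the opposite category $\mathbf{C}^{\mathrm{op}}$ has the Ramsey property for objects. *)

(* Defs.v *)
From HB Require Import structures.
From mathcomp Require Import all_boot all_order.
From mathcomp Require Import boolp classical_sets.

Set Implicit Arguments.
Unset Strict Implicit.
Unset Printing Implicit Defensive.

Local Open Scope classical_set_scope.

Record category := Category {
  obj : Type;
  hom : obj -> obj -> Type;
  idm : forall A : obj, hom A A;
  comp : forall A B C : obj, hom B C -> hom A B -> hom A C;
  comp1m : forall (A B : obj) (f : hom A B), comp (idm B) f = f;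
  compm1 : forall (A B : obj) (f : hom A B), comp f (idm A) = f;
  compA : forall (A B C D : obj) (h : hom C D) (g : hom B C) (f : hom A B),
    comp h (comp g f) = comp (comp h g) f }.

Arguments hom : clear implicits.
Arguments idm : clear implicits.
Arguments comp {c A B C} _ _.

Definition op (C : category) : category :=
  @Category (obj C) (fun A B => hom C B A) (idm C)
    (fun _ _ _ g f => comp f g)
    (fun _ _ f => compm1 f) (fun _ _ f => comp1m f)
    (fun _ _ _ _ h g f => esym (compA f g h)).

Section Ramsey.
Variable C : category.
Implicit Types A B D : obj C.

Definition invertible A (a : hom C A A) : Prop :=
  exists b : hom C A A, comp a b = idm C A /\ comp b a = idm C A.

Definition aut_equiv A B (f f' : hom C A B) : Prop :=
  exists a : hom C A A, invertible a /\ f' = comp f a.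

Lemma aut_equiv_refl A B (f : hom C A B) : aut_equiv f f.
Proof.
by exists (idm C A); split; [exists (idm C A); rewrite comp1m | rewrite compm1].
Qed.

Lemma aut_equiv_sym A B (f g : hom C A B) : aut_equiv f g -> aut_equiv g f.
Proof.
move=> [a [[b [ab ba]] ->]]; exists b; split; first by exists a.
by rewrite -compA ab compm1.
Qed.

Lemma aut_equiv_trans A B (f g h : hom C A B) :
  aut_equiv f g -> aut_equiv g h -> aut_equiv f h.
Proof.
move=> [a [[a' [aa' a'a]] ->]] [b [[b' [bb' b'b]] ->]].
exists (comp a b); split; last by rewrite compA.
exists (comp b' a'); split.
  by rewrite compA -(compA a b b') bb' compm1.
by rewrite compA -(compA b' a' a) a'a compm1.
Qed.

(* Elements of the quotient of hom(A, B) are represented as equivalence classes,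
   i.e. as subsets of hom(A, B). *)
Definition aut_class A B (f : hom C A B) : set (hom C A B) :=
  [set f' | aut_equiv f f'].

Definition binom B A : set (set (hom C A B)) := range (@aut_class A B).
Arguments binom : clear implicits.

Definition act A B D (w : hom C B D) (c : set (hom C A B)) :
  set (hom C A D) := comp w @` c.

Lemma act_class A B D (w : hom C B D) (f : hom C A B) :
  act w (aut_class f) = aut_class (comp w f).
Proof.
apply/seteqP; split=> [_ [_ [a [ia ->]] <-]|_ [a [ia ->]]].
  by exists a; split=> //; rewrite compA.
by exists (comp f a); [exists a | rewrite compA].
Qed.

Definition coloring (T : Type) (k : nat) (S : set T) (M : 'I_k -> set T) :
  Prop := \bigcup_i M i = S /\ trivIset setT M.

Definition ramsey_property : Prop :=
  forall (k : nat) (A B : obj C), 2 <= k -> inhabited (hom C A B) ->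
  exists D : obj C, forall M : 'I_k -> set (set (hom C A D)),
    coloring (binom D A) M ->
    exists (i : 'I_k) (w : hom C B D), act w @` binom B A `<=` M i.

End Ramsey.
Arguments binom {C} B A.

Definition dual_ramsey_property (C : category) : Prop :=
  ramsey_property (op C).

Record finDistrLat := FinDistrLat {
  fdl_disp : Order.disp_t;
  fdl_sort :> finTBDistrLatticeType fdl_disp }.

(* The library's {tblmorphism A -> B} only requires preservation of \bot and
   \top, not of meets and joins, so all four conditions are listed here. *)
Definition is_surj_lattice_hom (A B : finDistrLat) (f : A -> B) : Prop :=
  [/\ Order.meet_morphism f, Order.join_morphism f,
      f Order.bottom = Order.bottom, f Order.top = Order.top
    & forall y : B, exists x : A, f x = y].

Definition surj_hom (A B : finDistrLat) : Type :=
  {f : A -> B | is_surj_lattice_hom f}.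

Lemma surj_hom_id_subproof (A : finDistrLat) :
  is_surj_lattice_hom (fun x : A => x).
Proof. by split=> // y; exists y. Qed.

Lemma surj_hom_comp_subproof (A B C : finDistrLat)
    (g : surj_hom B C) (f : surj_hom A B) :
  is_surj_lattice_hom (fun x => sval g (sval f x)).
Proof.
case: g f => [g [gm gj gb gt gs]] [f [fm fj fb ft fs]] /=; split.
- by move=> x y; rewrite fm gm.
- by move=> x y; rewrite fj gj.
- by rewrite fb gb.
- by rewrite ft gt.
- by move=> z; have [y <-] := gs z; have [x <-] := fs y; exists x.
Qed.

Definition surj_hom_id (A : finDistrLat) : surj_hom A A :=
  exist _ _ (surj_hom_id_subproof A).

Definition surj_hom_comp (A B C : finDistrLat)
    (g : surj_hom B C) (f : surj_hom A B) : surj_hom A C :=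
  exist _ _ (surj_hom_comp_subproof g f).

Lemma surj_hom_comp1m (A B : finDistrLat) (f : surj_hom A B) :
  surj_hom_comp (surj_hom_id B) f = f.
Proof. by case: f => f fP; exact: eq_exist. Qed.

Lemma surj_hom_compm1 (A B : finDistrLat) (f : surj_hom A B) :
  surj_hom_comp f (surj_hom_id A) = f.
Proof. by case: f => f fP; exact: eq_exist. Qed.

Lemma surj_hom_compA (A B C D : finDistrLat)
    (h : surj_hom C D) (g : surj_hom B C) (f : surj_hom A B) :
  surj_hom_comp h (surj_hom_comp g f) = surj_hom_comp (surj_hom_comp h g) f.
Proof. exact: eq_exist. Qed.

Definition Dsurj : category :=
  @Category finDistrLat surj_hom surj_hom_id surj_hom_comp
    surj_hom_comp1m surj_hom_compm1 surj_hom_compA.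

(* Main.v *)
(* Under Birkhoff duality the statement concerns finite posets and embeddings.
   Take for A the rigid poset a < b together with an isolated point c, and for B
   two disjoint chains x1 < x2 and y1 < y2.  Fix any linear order on the points
   of a poset and colour a copy of A by whether its c comes before its a.  The
   copies (x1 < x2, y1) and (y1 < y2, x1) of A in a copy of B then always get
   different colours.  On the lattice side, A is 3 x 2, B is 3 x 3, and the
   points a and c of a copy of A in the lattice D are the preimages, under a
   surjection D -> A, of the prime filters generated by (1, 0) and (0, 1). *)
Require Import Defs.
From HB Require Import structures.
From mathcomp Require Import all_boot all_order.
From mathcomp Require Import boolp classical_sets.

Set Implicit Arguments.
Unset Strict Implicit.
Unset Printing Implicit Defensive.

(* The library puts bounds and a total order on ordinals but never joins them. *)
HB.instance Definition _ (n : nat) := Order.Total.on 'I_n.+1.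

Definition chain3x2 : finDistrLat :=
  FinDistrLat (Order.FinTBDistrLattice.clone _ ('I_3 *p bool)%type _).
Definition chain3x3 : finDistrLat :=
  FinDistrLat (Order.FinTBDistrLattice.clone _ ('I_3 *p 'I_3)%type _).

Definition o1 : 'I_3 := Ordinal (isT : 1 < 3).

Lemma ord3_ind (P : 'I_3 -> Prop) :
  P ord0 -> P o1 -> P ord_max -> forall i, P i.
Proof.
move=> P0 P1 P2 [[|[|[|//]]] ilt].
- by have -> : Ordinal ilt = ord0 by exact: val_inj.
- by have -> : Ordinal ilt = o1 by exact: val_inj.
- by have -> : Ordinal ilt = ord_max by exact: val_inj.
Qed.

(** The only complementary pair other than bottom and top is [b], [c]; since [c] is an atom and [b]
    is not, [h] cannot swap them. Then [a], the only element strictly between bottom and [b], is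
    fixed too. *)
Lemma chain3x2_rigid (h : chain3x2 -> chain3x2) :
  is_surj_lattice_hom h -> injective h -> forall x, h x = x.
Proof.
case=> hm hj hb ht _ hI.
pose a : chain3x2 := (o1, false).
pose b : chain3x2 := (ord_max, false).
pose c : chain3x2 := (ord0, true).
have ab : Order.meet (h a) (h b) == h a.
  by rewrite -hm; apply/eqP; congr h; apply/eqP.
have bc0 : Order.meet (h b) (h c) == Order.bottom.
  by rewrite -hm -hb; apply/eqP; congr h; apply/eqP.
have bc1 : Order.join (h b) (h c) == Order.top.
  by rewrite -hj -ht; apply/eqP; congr h; apply/eqP.
have a0 : h a != Order.bottom by rewrite -hb (inj_eq hI).
have c0 : h c != Order.bottom by rewrite -hb (inj_eq hI).
have anb : h a != h b by rewrite (inj_eq hI).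
have [/eqP ha /eqP hb' /eqP hc] : [/\ h a == a, h b == b & h c == c].
  move: (h a) (h b) (h c) ab bc0 bc1 a0 c0 anb.
  case=> u1 u2 [v1 v2] [w1 w2].
  elim/ord3_ind: u1; elim/ord3_ind: v1; elim/ord3_ind: w1;
    case: u2; case: v2; by case: w2.
(* Every element is a join of [a], [b], [c], apart from bottom, which [hb] covers. *)
have hJ (x y z : chain3x2) :
    h x = x -> h y = y -> Order.join x y == z -> h z = z.
  by move=> hx hy /eqP <-; rewrite hj hx hy.
case=> x1 x2; elim/ord3_ind: x1; case: x2.
- exact: (hJ c c).
- exact: (hJ _ _ _ hb hb).
- exact: (hJ a c).
- exact: (hJ a a).
- exact: (hJ b c).
- exact: (hJ b b).
Qed.

Lemma rigid_invertible (a : surj_hom chain3x2 chain3x2) :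
  @invertible (op Dsurj) chain3x2 a -> forall x, sval a x = x.
Proof.
case=> [b [/= ab _]]; apply: chain3x2_rigid; first exact: svalP.
have bK x : sval b (sval a x) = x by move/(congr1 sval)/(congr1 (@^~ x)): ab.
by move=> x y axy; rewrite -[x]bK axy bK.
Qed.

(** The duals of the embeddings of A onto (x1 < x2, y1) and (y1 < y2, x1). *)
Definition proj12_fun (x : chain3x3) : chain3x2 := (x.1, ord0 != x.2).
Definition proj21_fun (x : chain3x3) : chain3x2 := (x.2, ord0 != x.1).

Lemma proj12_subproof : is_surj_lattice_hom proj12_fun.
Proof.
split=> [[x1 x2] [y1 y2]|[x1 x2] [y1 y2]|||[y1 y2]].
- by apply/eqP; elim/ord3_ind: x1; elim/ord3_ind: x2;
    elim/ord3_ind: y1; elim/ord3_ind: y2.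
- by apply/eqP; elim/ord3_ind: x1; elim/ord3_ind: x2;
    elim/ord3_ind: y1; elim/ord3_ind: y2.
- exact/eqP.
- exact/eqP.
- by exists (y1, if y2 then o1 else ord0); case: y2.
Qed.

Lemma proj21_subproof : is_surj_lattice_hom proj21_fun.
Proof.
split=> [[x1 x2] [y1 y2]|[x1 x2] [y1 y2]|||[y1 y2]].
(* [proj21_fun] is [proj12_fun] after swapping the coordinates. *)
- exact: (let: And5 m _ _ _ _ := proj12_subproof in m (x2, x1) (y2, y1)).
- exact: (let: And5 _ j _ _ _ := proj12_subproof in j (x2, x1) (y2, y1)).
- exact/eqP.
- exact/eqP.
- by exists (if y2 then o1 else ord0, y1); case: y2.
Qed.

Definition proj12 : surj_hom chain3x3 chain3x2 := exist _ _ proj12_subproof.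
Definition proj21 : surj_hom chain3x3 chain3x2 := exist _ _ proj21_subproof.

Section Coloring.
Variable D : finDistrLat.
Implicit Types f : surj_hom D chain3x2.

Definition filter_a f : {ffun D -> bool} :=
  [ffun d => ord0 != (sval f d).1].
Definition filter_c f : {ffun D -> bool} := [ffun d => (sval f d).2].

(** The linear order is the enumeration of all boolean functions on [D], so it does not depend on
    [f]. *)
Definition c_before_a f : bool :=
  enum_rank (filter_c f) < enum_rank (filter_a f).

Definition class_c_before_a (s : set (surj_hom D chain3x2)) : Prop :=
  exists2 f, s f & c_before_a f.

Definition order_coloring (i : 'I_2) : set (set (surj_hom D chain3x2)) :=
  fun s => @binom (op Dsurj) D chain3x2 s /\
    `[< class_c_before_a s >] = (i == ord0).

Lemma order_coloringP :
  coloring (@binom (op Dsurj) D chain3x2) order_coloring.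
Proof.
split; last first.
  move=> i j _ _ [s [[_ si] [_ sj]]]; move: sj; rewrite si.
  by case: i {si} => [[|[|//]] ?]; case: j => [[|[|//]] ?] // _;
    apply: val_inj.
apply/seteqP; split=> [s [i _ []] //|s sbin].
exists (if `[< class_c_before_a s >] then ord0 else ord_max) => //.
by split=> //; case: `[< _ >].
Qed.

(** By rigidity the class of [f] is a singleton. *)
Lemma class_c_before_aE f :
  `[< class_c_before_a (@aut_class (op Dsurj) _ _ f) >] = c_before_a f.
Proof.
apply/asboolP/idP => [[_ [a [/rigid_invertible aid ->]]]|fc]; last first.
  by exists f => //; exact: aut_equiv_refl.
suff -> : Defs.comp (c := op Dsurj) f a = f by [].
case: f => f fP; apply: eq_exist; apply/funext => x; exact: aid.
Qed.

(** The two composites exchange the roles of the same two filters, so the colours differ once these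
    filters are distinct. *)
Lemma c_before_a_proj (w : surj_hom D chain3x3) :
  c_before_a (surj_hom_comp proj12 w) != c_before_a (surj_hom_comp proj21 w).
Proof.
rewrite /c_before_a.
have -> : filter_c (surj_hom_comp proj21 w) = filter_a (surj_hom_comp proj12 w).
  by apply/ffunP => d; rewrite !ffunE.
have -> : filter_a (surj_hom_comp proj21 w) = filter_c (surj_hom_comp proj12 w).
  by apply/ffunP => d; rewrite !ffunE.
case: ltngtP => // /val_inj/enum_rank_inj/ffunP eq_filter.
(* A preimage of this element lies in exactly one of the two filters. *)
have [_ _ _ _ /(_ (ord0, ord_max)) [d wd]] := svalP w.
by have := eq_filter d; rewrite !ffunE /= wd.
Qed.

End Coloring.

Theorem theorem3p1 : ~ dual_ramsey_property Dsurj.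
Proof.
move=> /(_ 2 chain3x2 chain3x3 isT (inhabits proj12)) [D].
move=> /(_ _ (order_coloringP D)) [i [w sub]].
(* The colour is then the same for [proj12] and [proj21]. *)
have col p : c_before_a (surj_hom_comp p w) = (i == ord0).
  have [_ <-] : order_coloring i
      (@aut_class (op Dsurj) chain3x2 D (surj_hom_comp p w)).
    apply: sub; exists (@aut_class (op Dsurj) chain3x2 chain3x3 p).
      by exists p.
    exact: act_class.
  by rewrite class_c_before_aE.
by have := c_before_a_proj w; rewrite !col eqxx.
Qed.
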